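(* Let $k\geq 2$, let $p=z^k-w^k$, let $n\ge 1$, and let $A^{n-1}$ be the $n\times n$ Toeplitz matrix associated with $p$. Write $n=kq+r$ with integers $q\ge 0$ and $0\leq r<k$. Then, after a permutation of rows and columns according to the residue classes of the indices modulo $k$, the matrix $A^{n-1}$ is permutation similar to $$B_0\oplus B_1\oplus\cdots\oplus B_{k-1},$$ where $B_0,\ldots,B_{r-1}\cong T_{q+1}$ and $B_r,\ldots,B_{k-1}\cong T_q$. Consequently, $$\det A^{n-1}=(q+2)^r(q+1)^{k-r}.$$
   Context: The inner product is that of the Hardy space $H^2(\mathbb D^2)$ of the bidisk with coordinates $(z,w)$, in which the monomials $z^aw^b$ ($a,b\ge0$) are orthonormal. For a homogeneous polynomial $p$ and $N\ge0$, the associated matrix $A^N$ is the $(N+1)\times(N+1)$ Toeplitz matrix $(a_{i,l})_{i,l=0}^N$ with $a_{i,l}=\langle p z^{l}w^{N-l},\,p z^{i}w^{N-i}\rangle$, i.e. $a_{i,l}=\langle pw^{i-l},pz^{i-l}\rangle$ for $i\ge l$ and $a_{i,l}=\overline{a_{l,i}}$ for $i<l$. $T_m$ is the $m\times m$ tridiagonal matrix with $2$ on the diagonal, $-1$ on the sub- and superdiagonals, and $0$ elsewhere; $T_0$ is the empty matrix, with $\det T_0=1$. Block $B_s$ is the one corresponding to the indices in $\{0,\dots,n-1\}$ congruent to $s$ modulo $k$, in increasing order; $B_s\cong T_m$ means that $B_s$ is (a copy of) $T_m$. *)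

(* Defs.v *)
From mathcomp Require Import all_boot all_order all_algebra.
From mathcomp Require Import complex reals mpoly.

Set Implicit Arguments.
Unset Strict Implicit.
Unset Printing Implicit Defensive.

Import GRing.Theory Num.Theory.
Local Open Scope ring_scope.

Section HardyToeplitz.
Variable C : numClosedFieldType.

(* The coordinates (z, w) of the bidisk are the two variables of {mpoly C[2]}. *)
Definition zvar : {mpoly C[2]} := 'X_ord0.
Definition wvar : {mpoly C[2]} := 'X_ord_max.

(* The inner product of H^2(D^2) on polynomials, linear in the first argument:
   the sum over all exponents of p@_m * (q@_m)^*, whose terms vanish outside
   msupp p. *)
Definition hardy_dot (p q : {mpoly C[2]}) : C :=
  \sum_(m <- msupp p) p@_m * (q@_m)^*.

Lemma hardy_dot_monomial (m1 m2 : 'X_{1..2}) :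
  hardy_dot 'X_[m1] 'X_[m2] = (m1 == m2)%:R.
Proof.
by rewrite /hardy_dot msuppX big_seq1 !mcoeffX eqxx mul1r rmorph_nat eq_sym.
Qed.

Definition hardy_toeplitz (p : {mpoly C[2]}) (N : nat) : 'M[C]_N.+1 :=
  \matrix_(i, l) hardy_dot (p * zvar ^+ l * wvar ^+ (N - l))
                           (p * zvar ^+ i * wvar ^+ (N - i)).

Definition tridiag (m : nat) : 'M[C]_m :=
  \matrix_(i, j) (if i == j then 2
                  else if (i.+1 == j :> nat) || (j.+1 == i :> nat) then -1
                  else 0).

Definition residue_class (m k s : nat) : {set 'I_m} :=
  [set i : 'I_m | (i %% k)%N == s].

(* On a set of ordinals, enum_val lists the elements in increasing order. *)
Definition residue_block m (A : 'M[C]_m) (k s : nat) :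
    'M[C]_#|residue_class m k s| :=
  mxsub enum_val enum_val A.

(* Equality of square matrices whose sizes are only provably equal. *)
Definition copy_of m1 m2 (B1 : 'M[C]_m1) (B2 : 'M[C]_m2) : Prop :=
  exists e : m1 = m2, castmx (e, e) B1 = B2.

End HardyToeplitz.

Arguments zvar {C}.
Arguments wvar {C}.

(* Main.v *)
(** In the monomial basis, p z^l w^(N-l) = z^(k+l) w^(N-l) - z^l w^(N-l+k), and
    all these vectors have the same degree k + N, so that their monomials are
    told apart by the exponent of z alone. Hence the (i, l) entry of the matrix
    is 2 if i = l, -1 if |i - l| = k and 0 otherwise. It vanishes unless i and l
    are congruent modulo k, and on the indices s, s + k, s + 2k, ... it is the
    tridiagonal matrix T_m, whose determinant m + 1 comes from the recurrence
    det T_(m+2) = 2 det T_(m+1) - det T_m. *)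

Require Import Defs.
From mathcomp Require Import all_boot all_order all_fingroup all_algebra.
From mathcomp Require Import complex reals mpoly.
Set Implicit Arguments.
Unset Strict Implicit.
Unset Printing Implicit Defensive.

Import GRing.Theory Num.Theory.
Local Open Scope ring_scope.

(** * Determinants of cast and block-diagonal matrices *)

Lemma det_castmx (R : comPzRingType) (m n : nat) (e : m = n) (M : 'M[R]_m) :
  \det (castmx (e, e) M) = \det M.
Proof. by case: _ / e; rewrite castmx_id. Qed.

Lemma det_mxdiag (R : comPzRingType) (p : nat) (p_ : 'I_p -> nat)
    (B : forall i, 'M[R]_(p_ i)) :
  \det (\mxdiag_i B i) = \prod_i \det (B i).
Proof.
elim: p p_ B => [|p IHp] p_ B.
  (* The size here is an empty sum, which is rewritten to 0 only after generalizing over it. *)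
  have det_0 (n : nat) (M : 'M[R]_n) : n = 0%N -> \det M = 1.
    by move=> n0; move: M; rewrite n0 => M; rewrite det_mx00.
  by rewrite [RHS]big_ord0; apply: det_0; rewrite big_ord0.
by rewrite mxdiag_recl det_castmx det_ublock IHp big_ord_recl.
Qed.

(** * The inner product and the entries of the Toeplitz matrix *)

Section HardyToeplitz.
Variable C : numClosedFieldType.

Lemma det_copy_of (m1 m2 : nat) (B1 : 'M[C]_m1) (B2 : 'M[C]_m2) :
  copy_of B1 B2 -> \det B1 = \det B2.
Proof. by case=> eq_m <-; rewrite det_castmx. Qed.

(** The extra terms vanish with the coefficients of [p]. A common list [s] is what allows sums over
    the supports of [p1], [p2] and [p1 - p2] to be compared term by term. *)
Lemma hardy_dot_sum (p q : {mpoly C[2]}) (s : seq 'X_{1..2}) :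
  uniq s -> {subset msupp p <= s} ->
  hardy_dot p q = \sum_(m <- s) p@_m * (q@_m)^*.
Proof.
move=> s_uniq sub_s; rewrite [RHS](bigID (mem (msupp p))) /=.
rewrite [X in _ + X]big1 ?addr0 => [|m /memN_msupp_eq0 ->]; last by rewrite mul0r.
rewrite -big_filter; apply: perm_big; apply: uniq_perm; rewrite ?filter_uniq //.
by move=> m; rewrite mem_filter; case: (boolP (m \in msupp p)) => //= /sub_s ->.
Qed.

Lemma hardy_dotBl (p1 p2 q : {mpoly C[2]}) :
  hardy_dot (p1 - p2) q = hardy_dot p1 q - hardy_dot p2 q.
Proof.
pose s := undup (msupp p1 ++ msupp p2).
have s_uniq : uniq s by rewrite undup_uniq.
rewrite !(@hardy_dot_sum _ _ s) //.
- by rewrite -sumrB; apply: eq_bigr => m _; rewrite mcoeffB mulrBl.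
- by move=> m; rewrite mem_undup mem_cat orbC => ->.
- by move=> m; rewrite mem_undup mem_cat => ->.
- by move=> m /msuppB_le; rewrite mem_undup.
Qed.

Lemma hardy_dotBr (p q1 q2 : {mpoly C[2]}) :
  hardy_dot p (q1 - q2) = hardy_dot p q1 - hardy_dot p q2.
Proof.
by rewrite -sumrB; apply: eq_bigr => m _; rewrite mcoeffB rmorphB mulrBr.
Qed.

Definition zw_exp (a b : nat) : 'X_{1..2} := (U_(ord0) *+ a + U_(ord_max) *+ b)%MM.

Lemma zw_expE (a b : nat) : 'X_[zw_exp a b] = zvar ^+ a * wvar ^+ b :> {mpoly C[2]}.
Proof. by rewrite mpolyXD !mpolyXn. Qed.

Lemma eq_zw_exp (a b c d : nat) :
  (zw_exp a b == zw_exp c d) = (a == c) && (b == d).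
Proof.
apply/eqP/andP => [/mnmP eq_ab | [/eqP -> /eqP ->] //].
move: (eq_ab ord0) (eq_ab ord_max).
by rewrite !mnmDE !mulmnE !mnm1E /= !mul0n !mul1n !addn0 !add0n => -> ->.
Qed.

Lemma hardy_toeplitz_zkwk (k N : nat) (i l : 'I_N.+1) :
  hardy_toeplitz (zvar ^+ k - wvar ^+ k : {mpoly C[2]}) N i l =
  (i == l :> nat)%:R *+ 2 - (l + k == i)%N%:R - (i + k == l)%N%:R.
Proof.
have le_N (j : 'I_N.+1) : (j <= N)%N by rewrite -ltnS.
have pzwE (j : 'I_N.+1) :
    (zvar ^+ k - wvar ^+ k) * zvar ^+ j * wvar ^+ (N - j) =
    'X_[zw_exp (j + k) (N - j)] - 'X_[zw_exp j (N - j + k)] :> {mpoly C[2]}.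
  rewrite !zw_expE !exprD !mulrBl; congr (_ - _).
    by rewrite (mulrC (zvar ^+ k)).
  by rewrite (mulrC (wvar ^+ k)) mulrAC mulrA.
have eq_exp (a b c d : nat) : (a + b = c + d)%N ->
    (zw_exp a b == zw_exp c d) = (a == c).
  move=> eq_deg; rewrite eq_zw_exp; case: (eqVneq a c) => //= eq_ac.
  by rewrite -(eqn_add2l a) eq_deg eq_ac eqxx.
rewrite mxE !pzwE hardy_dotBl !hardy_dotBr !hardy_dot_monomial.
have degS (j : 'I_N.+1) : (j + k + (N - j) = k + N)%N.
  by rewrite addnAC subnKC // addnC.
have deg0 (j : 'I_N.+1) : (j + (N - j + k) = k + N)%N.
  by rewrite addnA subnKC // addnC.
rewrite !eq_exp ?degS ?deg0 // eqn_add2r (eq_sym (val l)) (eq_sym (val l) (_ + _)%N).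
by rewrite opprB mulr2n addrACA addrA.
Qed.

(** * The determinant of the tridiagonal matrix *)

Lemma det_tridiag (m : nat) : \det (tridiag C m) = m.+1%:R.
Proof.
(* The recurrence has order two, so the induction carries two consecutive determinants. *)
suff [] : \det (tridiag C m) = m.+1%:R /\ \det (tridiag C m.+1) = m.+2%:R by [].
elim: m => [|m [IHm IHm1]]; first by rewrite det_mx00 det_mx11 mxE eqxx.
split=> //; rewrite (expand_det_row _ ord0) !big_ord_recl big1 => [|i _]; last first.
  by rewrite mxE /= mul0r.
rewrite !mxE /= addr0 /cofactor /= !expr0 !mul1r.
have -> : row' ord0 (col' ord0 (tridiag C m.+2)) = tridiag C m.+1.
  by apply/matrixP => i j; rewrite !mxE /= (inj_eq lift_inj) /bump /= !add1n !eqSS.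
(* The other minor keeps column 0 but loses row 0, so its first column has the single nonzero entry
   -1; expanding along it leaves T_m. *)
rewrite IHm1 [in X in _ + X](expand_det_col _ ord0) big_ord_recl big1 => [|i _]; last first.
  by rewrite !mxE /= mul0r.
rewrite addr0 !mxE /= /cofactor /= !expr0 !mul1r.
set M := row' _ _; have -> : M = tridiag C m.
  apply/matrixP => i j; rewrite !mxE /= -!val_eqE /= /bump /=.
  by rewrite !add1n !eqSS.
rewrite IHm /bump /= expr1 !mulN1r opprK; apply/eqP.
by rewrite subr_eq -natrM -natrD mul2n -addnn addSnnS addnC.
Qed.

(** * Enumeration of a residue class and the blocks it cuts out *)

Lemma val_enum_residue_class (n k s m : nat) : (s < k)%N ->
    (forall j, (j < m)%N = (s + k * j < n)%N) ->
  [seq val x | x <- enum (residue_class n k s)] =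
  [seq (s + k * j)%N | j <- iota 0 m].
Proof.
move=> lt_sk lt_m; have k_gt0 : (0 < k)%N by apply: leq_ltn_trans lt_sk.
(* Both lists are strictly increasing, so having the same members makes them equal. *)
apply: (irr_sorted_eq ltn_trans ltnn).
- have -> : [seq val x | x <- enum (residue_class n k s)] =
            [seq x <- iota 0 n | x %% k == s]%N.
    rewrite -val_enum_ord filter_map; congr map.
    by rewrite enumT; apply: eq_filter => x; rewrite !inE.
  by apply: (sorted_filter ltn_trans); apply: iota_ltn_sorted.
- rewrite sorted_map (sub_sorted _ (iota_ltn_sorted 0 m)) // => i j lt_ij.
  by rewrite /= ltn_add2l ltn_pmul2l.
move=> x; apply/mapP/mapP => [[y]|[j]].
  rewrite mem_enum inE => /eqP y_mod ->; exists (y %/ k)%N.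
    rewrite mem_iota /= add0n lt_m -[X in (X + _)%N]y_mod.
    by rewrite addnC mulnC -divn_eq.
  by rewrite -[X in (X + _)%N]y_mod addnC mulnC -divn_eq.
rewrite mem_iota add0n /= lt_m => lt_n ->; exists (Ordinal lt_n) => //.
by rewrite mem_enum inE /= mulnC addnC modnMDl modn_small.
Qed.

Lemma card_residue_class (n k s m : nat) : (s < k)%N ->
    (forall j, (j < m)%N = (s + k * j < n)%N) -> #|residue_class n k s| = m.
Proof.
move=> lt_sk /(@val_enum_residue_class n k s m lt_sk) /(congr1 size).
by rewrite !size_map size_iota -cardE.
Qed.

Lemma val_enum_val_residue_class (n k s m : nat) (j : 'I_#|residue_class n k s|) :
    (s < k)%N -> (forall i, (i < m)%N = (s + k * i < n)%N) ->
  enum_val j = (s + k * j)%N :> nat.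
Proof.
move=> lt_sk lt_m; have lt_jm : (j < m)%N.
  by rewrite -(card_residue_class lt_sk lt_m).
rewrite (enum_val_nth (enum_val j)) -(nth_map _ 0%N val) -?cardE //.
by rewrite (val_enum_residue_class lt_sk lt_m) (nth_map 0%N) ?size_iota // nth_iota.
Qed.

(** Under [i -> s + k * i], a shift by [k] in the matrix becomes a shift by 1 in the block. The size
    [m] is fixed only by the bound on [j], so that the sizes q and q + 1 are treated alike. *)
Lemma residue_block_zkwk (k N s m : nat) : (s < k)%N ->
    (forall j, (j < m)%N = (s + k * j < N.+1)%N) ->
  copy_of (residue_block (hardy_toeplitz (zvar ^+ k - wvar ^+ k : {mpoly C[2]}) N) k s)
          (tridiag C m).
Proof.
move=> lt_sk lt_m; exists (card_residue_class lt_sk lt_m).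
have k_gt0 : (0 < k)%N by apply: leq_ltn_trans lt_sk.
apply/matrixP => i j; rewrite castmxE mxE hardy_toeplitz_zkwk.
rewrite !(val_enum_val_residue_class _ lt_sk lt_m) /=.
rewrite -!addnA -!mulnSr !eqn_add2l !eqn_pmul2l // mxE -val_eqE /=.
(* In each case at most one of the three indicators can be nonzero. *)
case: (ltngtP i j) => [lt_ij|lt_ji|->]; last first.
- by rewrite !gtn_eqF // !subr0 mulr1n.
- rewrite (gtn_eqF (ltnW lt_ji : (j < i.+1)%N)) mul0rn sub0r subr0 /=.
  by case: (_ == _); rewrite ?oppr0.
- rewrite (gtn_eqF (ltnW lt_ij : (i < j.+1)%N)) mul0rn subr0 sub0r orbF.
  by case: (_ == _); rewrite ?oppr0.
Qed.

End HardyToeplitz.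

(** * The permutation that groups the indices by residue class *)

Section ResiduePermutation.
Variables (n k : nat).
Hypothesis k_gt0 : (0 < k)%N.

Lemma sum_card_residue_class : (\sum_(s < k) #|residue_class n k s|)%N = n.
Proof.
rewrite -[RHS]card_ord -sum1_card.
rewrite (partition_big (fun i : 'I_n => Ordinal (ltn_pmod i k_gt0)) xpredT) //=.
apply: eq_bigr => s _; rewrite -sum1_card; apply: eq_bigl => i.
by rewrite inE -val_eqE.
Qed.

Definition residue_val (u : {s : 'I_k & 'I_#|residue_class n k s|}) : 'I_n :=
  enum_val (tagged u).

Lemma residue_val_mod (u : {s : 'I_k & 'I_#|residue_class n k s|}) :
  (residue_val u %% k)%N = tag u.
Proof. by apply/eqP; have := enum_valP (tagged u); rewrite inE. Qed.

Lemma residue_val_inj : injective residue_val.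
Proof.
move=> u v eq_uv; have : tag u = tag v.
  by apply: val_inj; rewrite /= -!residue_val_mod eq_uv.
case: u v eq_uv => [s j] [t l] /= + eq_st; case: _ / eq_st in l * => eq_jl.
by congr (Tagged _ _); apply: enum_val_inj.
Qed.

Let e := sum_card_residue_class.

(** [tagnat.sig] reads a position in the concatenated blocks as a block together with an offset in
    it. *)
Definition residue_perm_fun (i : 'I_n) : 'I_n :=
  residue_val (tagnat.sig (cast_ord (esym e) i)).

Lemma residue_perm_fun_inj : injective residue_perm_fun.
Proof.
by move=> i j /residue_val_inj /tagnat.sig_inj /cast_ord_inj.
Qed.

Definition residue_perm : 'S_n := perm residue_perm_fun_inj.

Lemma residue_permE (s : 'I_k) (j : 'I_#|residue_class n k s|) :
  residue_perm (cast_ord e (tagnat.Rank s j)) = enum_val j.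
Proof. by rewrite permE /residue_perm_fun cast_ordK tagnat.rankK. Qed.

(** Conjugation puts [A (sigma i) (sigma j)] at place (i, j): positions in one block read off a
    submatrix on one class, and positions in different blocks give incongruent indices, where [A]
    vanishes. *)
Lemma residue_perm_mxdiag (R : pzRingType) (A : 'M[R]_n) :
    (forall i j : 'I_n, i != j %[mod k] -> A i j = 0) ->
  perm_mx residue_perm *m A *m (perm_mx residue_perm)^T =
  castmx (e, e) (\mxdiag_(s < k)
    (mxsub enum_val enum_val A : 'M[R]_#|residue_class n k s|)).
Proof.
move=> A_mod; rewrite -row_permE tr_perm_mx -col_permE.
apply/matrixP => i j; rewrite castmxE !mxE.
rewrite !permE /residue_perm_fun.
rewrite /tagnat.sig1 /tagnat.sig2.
case: (tagnat.sig _) => s a; case: (tagnat.sig _) => t b /=.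
case: eqP => [eq_st|/eqP neq_st]; last first.
  by rewrite mxE A_mod // !residue_val_mod.
(* Once the two tags are identified, the [conform_mx] inside [\mxdiag] is the identity. *)
case: _ / eq_st in b *.
by rewrite conform_mx_id mxE.
Qed.

End ResiduePermutation.

(** * Block sizes, decomposition and determinant *)

Theorem theorem3p1 (R : realType) (k n q r : nat)
    (k_ge2 : (2 <= k)%N) (n_ge1 : (1 <= n)%N)
    (n_div : n = (k * q + r)%N) (r_lt : (r < k)%N) :
  let A := hardy_toeplitz (zvar ^+ k - wvar ^+ k : {mpoly R[i][2]}) n.-1 in
  let B := residue_block A k in
  (exists (sigma : 'S_n.-1.+1)
     (e : (\sum_(s < k) #|residue_class n.-1.+1 k s|)%N = n.-1.+1),
     (forall (s : 'I_k) (j : 'I_#|residue_class n.-1.+1 k s|),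
        sigma (cast_ord e (tagnat.Rank s j)) = enum_val j)
     /\ perm_mx sigma *m A *m (perm_mx sigma)^T
        = castmx (e, e) (\mxdiag_(s < k) B s))
  /\ (forall s : nat, (s < r)%N -> copy_of (B s) (tridiag R[i] q.+1))
  /\ (forall s : nat, (r <= s < k)%N -> copy_of (B s) (tridiag R[i] q))
  /\ \det A = (q + 2)%:R ^+ r * (q + 1)%:R ^+ (k - r).
Proof.
move=> A B.
have k_gt0 : (0 < k)%N by apply: ltnW.
(* As s < r < k, the bound s + kj < kq + r amounts to j <= q. *)
have lt_big (s j : nat) : (s < r)%N -> (j < q.+1)%N = (s + k * j < n.-1.+1)%N.
  move=> lt_sr; rewrite prednK // n_div; apply/idP/idP => [|lt_n].
    by rewrite ltnS => le_jq; rewrite addnC -addnS leq_add // leq_mul2l le_jq orbT.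
  rewrite -(ltn_pmul2l k_gt0) mulnS addnC.
  apply: leq_ltn_trans (leq_addl s _) (ltn_trans lt_n _).
  by rewrite ltn_add2l.
(* As r <= s < k, the same bound now fails at j = q. *)
have lt_small (s j : nat) : (r <= s < k)%N -> (j < q)%N = (s + k * j < n.-1.+1)%N.
  case/andP=> le_rs lt_sk; rewrite prednK // n_div; apply/idP/idP => [lt_jq|lt_n].
    apply: (@leq_trans (k * j.+1)%N); first by rewrite mulnS ltn_add2r.
    by apply: leq_trans (leq_addr r _); rewrite leq_mul2l lt_jq orbT.
  rewrite -(ltn_pmul2l k_gt0) -(ltn_add2r r); apply: leq_ltn_trans lt_n.
  by rewrite addnC leq_add2r.
have Bbig (s : nat) : (s < r)%N -> copy_of (B s) (tridiag R[i] q.+1).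
  move=> lt_sr; apply: residue_block_zkwk => [|j]; first exact: ltn_trans r_lt.
  exact: lt_big.
have Bsmall (s : nat) : (r <= s < k)%N -> copy_of (B s) (tridiag R[i] q).
  move=> s_rk; apply: residue_block_zkwk => [|j]; first by case/andP: s_rk.
  exact: lt_small.
(* Each of the three indicators in the entry formula forces i and j to be congruent. *)
have A_mod (i j : 'I_n.-1.+1) : i != j %[mod k] -> A i j = 0.
  move=> neq_ij; rewrite hardy_toeplitz_zkwk.
  have [eq_ij|_] := eqVneq (i : nat) j; first by rewrite eq_ij eqxx in neq_ij.
  have [eq_ij|_] := eqVneq (j + k)%N i; first by rewrite -eq_ij modnDr eqxx in neq_ij.
  have [eq_ij|_] := eqVneq (i + k)%N j; first by rewrite -eq_ij modnDr eqxx in neq_ij.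
  by rewrite mul0rn !subr0.
have diagA := residue_perm_mxdiag k_gt0 A_mod.
split; [|split; [exact: Bbig | split; [exact: Bsmall|]]].
  exists (residue_perm n.-1.+1 k_gt0), (sum_card_residue_class _ k_gt0); split=> //.
  exact: residue_permE.
have -> : \det A = \prod_(s < k) \det (B s).
  rewrite -det_mxdiag -(det_castmx (sum_card_residue_class _ k_gt0)).
  (* The sign of the permutation occurs twice and squares to 1. *)
  rewrite -diagA !det_mulmx det_tr mulrAC -expr2.
  by rewrite det_perm sqrr_sign mul1r.
rewrite (eq_bigr (fun s : 'I_k => (if (s < r)%N then q.+2 else q.+1)%:R)) => [|s _].
  (* The product is split at [r]: the first r factors are q + 2, the other k - r are q + 1. *)
  rewrite -[in LHS](subnKC (ltnW r_lt)) big_split_ord /= addn2 addn1.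
  under eq_bigr do rewrite ltn_ord.
  under [X in _ * X]eq_bigr do rewrite ltnNge leq_addr.
  by rewrite !prodr_const !card_ord.
have [lt_sr|le_rs] := ltnP s r.
  by rewrite (det_copy_of (Bbig s lt_sr)) det_tridiag.
by rewrite (det_copy_of (Bsmall s _)) ?det_tridiag // le_rs ltn_ord.
Qed.
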